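(* For $T>0$ and $m_0\in[-1,1]$ consider, for unknown functions $z,m:[0,T]\to\mathbb{R}$, the mean field game system $$\dot z=\frac{z|z|}{2},\qquad \dot m=-m|z|+z,\qquad z(T)=2m(T),\qquad m(0)=m_0. \qquad (\mathrm{S})$$ Let $T(m_0)$ be the unique solution in $\left[\frac12,2\right]$ of the equation (in the unknown $T$) $$|m_0|=\frac{(2T-1)^2(T+4)}{27\,T}.$$ Then, for every $m_0\in[-1,1]\setminus\{0\}$, the system (S) admits: (i) a unique solution for $T<T(m_0)$; (ii) two distinct solutions (exactly two) for $T=T(m_0)$; (iii) three distinct solutions (exactly three) for $T>T(m_0)$. If $m_0=0$, then $T(0)=\frac12$ and (S) admits: (i) a unique solution for $T\le \frac12$; (ii) three distinct solutions (exactly three) for $T>\frac12$: the constant zero solution, $(z_+,m_+)$ and $(z_-,m_-)$, where $m_+(t)=-m_-(t)>0$ for every $t\in(0,T]$.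
   Context: A solution of (S) is a pair of continuously differentiable functions $(z,m)$ on $[0,T]$ satisfying the two ordinary differential equations together with the terminal condition on $z$ and the initial condition on $m$. The system is the mean field game system of a two-state model with state space $\{-1,1\}$, where $m(t)\in[-1,1]$ is the mean of the distribution of the representative player and $z(t)=u(t,-1)-u(t,1)$, with $u$ the value function; running cost $a^2/2$ ($a\ge 0$ the flip rate), terminal cost $G(x,m)=-mx$. *)

(* Defs.v *)
From Stdlib Require Import Reals List.
Import ListNotations.
Open Scope R_scope.

Definition time_interval (T : R) : R -> Prop := fun t => 0 <= t <= T.

(* [D_in] and [continue_in] take limits inside the set, so at 0 and T the
   derivative and the continuity are one-sided, and values outside [0,T]
   play no role. *)
Definition C1_on (T : R) (f : R -> R) : Prop :=
  exists f' : R -> R, forall t : R, time_interval T t ->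
    D_in f f' (time_interval T) t /\ continue_in f' (time_interval T) t.

Record mfg_solution (T m0 : R) (s : (R -> R) * (R -> R)) : Prop := {
  sol_z_C1 : C1_on T (fst s);
  sol_m_C1 : C1_on T (snd s);
  sol_z_ode : forall t : R, time_interval T t ->
    D_in (fst s) (fun r => fst s r * Rabs (fst s r) / 2) (time_interval T) t;
  sol_m_ode : forall t : R, time_interval T t ->
    D_in (snd s) (fun r => - snd s r * Rabs (fst s r) + fst s r)
         (time_interval T) t;
  sol_z_terminal : fst s T = 2 * snd s T;
  sol_m_initial : snd s 0 = m0
}.

(* Functions on [0,T] are represented by total functions up to agreement
   on [0,T]; solutions are compared and counted modulo this relation. *)
Definition agree_on (T : R) (s s' : (R -> R) * (R -> R)) : Prop :=
  forall t : R, time_interval T t -> fst s t = fst s' t /\ snd s t = snd s' t.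

Definition solution_list (T m0 : R) (l : list ((R -> R) * (R -> R))) : Prop :=
  Forall (mfg_solution T m0) l /\
  ForallOrdPairs (fun s s' => ~ agree_on T s s') l /\
  (forall s, mfg_solution T m0 s -> Exists (agree_on T s) l).

Definition exactly_n_solutions (n : nat) (T m0 : R) : Prop :=
  exists l : list ((R -> R) * (R -> R)), length l = n /\ solution_list T m0 l.

Definition transition_time (m0 T : R) : Prop :=
  1 / 2 <= T <= 2 /\ Rabs m0 = (2 * T - 1) ^ 2 * (T + 4) / (27 * T).

(* Main.v *)
Require Import Defs.
From Stdlib Require Import Reals List.
From Stdlib Require Import Lra FunctionalExtensionality.
From Coquelicot Require Import Coquelicot.
Import ListNotations.
Open Scope R_scope.

(** The system is reduced to a count of real roots by shooting on the
    terminal value [w = z(T)].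

    The equation for [z] does not involve [m], and since [x |x|] is
    nondecreasing the squared distance of two of its solutions is
    nondecreasing in time; so [z] is determined by [w] ([z_unique]), and it is
    [z(t) = 2 w / (2 + |w| (T - t))].  Given [z], the equation for [m] is
    linear and dissipative, so the squared distance of two of its solutions is
    nonincreasing, and [m] is determined by [m(0)] ([m_unique]).  In closed
    form, when [w > 0], [(1 - m) z^2] is constant in time; [m_sol] writes this
    and its mirror image for [w < 0] in one formula.  What remains is the
    terminal condition [w = 2 m(T)], which becomes
    [shooting T w = 8 m0], where [shooting T] is odd and equal on [w >= 0] to
    the cubic [C(w) = 8 - (2 - w) (2 + w T)^2].  Solutions of the system are
    thus in bijection with the real roots [w] ([solution_list_of_roots]).

    By oddness take [m0 >= 0].  The roots to count are then the positive [v]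
    with [C(v) = 8 m0] (which give [w = v]) or [C(v) = - 8 m0] (which give
    [w = - v]), and [w = 0] when [m0 = 0].
    If [m0 > 0], the level [8 m0] is attained exactly once on the positive
    axis ([cubic_increasing_branch]).  For the level [- 8 m0], the identity
    [cubic_at_crit] shows that, for [T > 1/2], the minimum of [C] on
    the positive axis is [- 8 h(T)] with [h(T) = (2T-1)^2 (T+4) / (27 T)], attained only at
    [(4T-2)/(3T)], so there are zero, one or two roots according to whether
    [h(T)] is below, equal to or above [m0]; for [T <= 1/2] the cubic is
    positive and there is none.  As [h] increases strictly on
    [T >= 1/2], from 0 at 1/2 to 1 at 2, this comparison is that of [T] with the transition time.
    If [m0 = 0], a positive root, then unique, exists if and only if
    [T > 1/2], and it comes with its opposite.
    Upper bounds on numbers of roots use the relations between roots and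
    coefficients, lower bounds the intermediate value theorem. *)

(** * One-sided derivatives on a closed interval *)

(** Composing with this retraction onto [[0,T]] turns continuity relative to
    the interval into continuity on the line, so that the mean value theorem
    applies up to the end points. *)
Definition clamp (T x : R) : R := Rmax 0 (Rmin T x).

Lemma clamp_in T x : 0 <= T -> time_interval T (clamp T x).
Proof.
  intros HT. unfold time_interval, clamp, Rmax, Rmin.
  repeat destruct (Rle_dec _ _); lra.
Qed.

Lemma clamp_id T x : time_interval T x -> clamp T x = x.
Proof.
  unfold time_interval, clamp, Rmax, Rmin; intros Hx.
  repeat destruct (Rle_dec _ _); lra.
Qed.

Lemma clamp_contracts T x y : Rabs (clamp T y - clamp T x) <= Rabs (y - x).
Proof.
  unfold clamp, Rmax, Rmin, Rabs.
  repeat destruct (Rle_dec _ _); repeat destruct (Rcase_abs _); lra.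
Qed.

Lemma continuity_pt_clamp T f x :
  time_interval T x -> continue_in f (time_interval T) x ->
  continuity_pt (fun y => f (clamp T y)) x.
Proof.
  intros Hx Hf eps Heps.
  destruct (Hf eps Heps) as [d [Hd Hlim]].
  exists d; split; [exact Hd|].
  intros y [_ Hy]. simpl in *. unfold Rdist in *.
  rewrite (clamp_id T x Hx).
  destruct (Req_dec (clamp T y) x) as [E|E].
  - rewrite E, Rminus_diag, Rabs_R0. exact Heps.
  - apply Hlim. split.
    + split; [apply clamp_in; unfold time_interval in Hx; lra | auto].
    + pose proof (clamp_contracts T x y) as Hc.
      rewrite (clamp_id T x Hx) in Hc. lra.
Qed.

Lemma is_derive_clamp T f f' x :
  0 < x < T -> D_in f f' (time_interval T) x ->
  is_derive (fun y => f (clamp T y)) x (f' x).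
Proof.
  intros Hx Hf. apply is_derive_Reals. intros eps Heps.
  destruct (Hf eps Heps) as [d [Hd Hlim]].
  assert (Hm : 0 < Rmin d (Rmin x (T - x)))
    by (repeat apply Rmin_pos; lra).
  exists (mkposreal _ Hm). intros h Hh0 Hh. simpl in Hh.
  assert (Hh1 : Rabs h < d) by (eapply Rlt_le_trans; [exact Hh|apply Rmin_l]).
  assert (Hh2 : Rabs h < Rmin x (T - x))
    by (eapply Rlt_le_trans; [exact Hh|apply Rmin_r]).
  assert (Hh3 : Rabs h < x) by (eapply Rlt_le_trans; [exact Hh2|apply Rmin_l]).
  assert (Hh4 : Rabs h < T - x)
    by (eapply Rlt_le_trans; [exact Hh2|apply Rmin_r]).
  apply Rabs_def2 in Hh3. apply Rabs_def2 in Hh4.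
  assert (Hxh : time_interval T (x + h)) by (unfold time_interval; lra).
  rewrite (clamp_id T (x + h) Hxh), (clamp_id T x)
    by (unfold time_interval; lra).
  specialize (Hlim (x + h)). simpl in Hlim. unfold Rdist in Hlim.
  replace (x + h - x) with h in Hlim by ring.
  apply Hlim. split; [split; [exact Hxh|lra] | exact Hh1].
Qed.

Lemma D_in_nondecreasing T f f' :
  (forall t, time_interval T t -> D_in f f' (time_interval T) t) ->
  (forall t, time_interval T t -> 0 <= f' t) ->
  forall s t, 0 <= s -> s <= t -> t <= T -> f s <= f t.
Proof.
  intros Hf Hpos s t Hs Hst Ht.
  destruct (MVT_gen (fun y => f (clamp T y)) s t f') as [c [Hc Heq]].
  - rewrite Rmin_left, Rmax_right by lra. intros x Hx.
    apply is_derive_clamp; [lra|]. apply Hf. unfold time_interval; lra.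
  - rewrite Rmin_left, Rmax_right by lra. intros x Hx.
    assert (Hx' : time_interval T x) by (unfold time_interval; lra).
    apply continuity_pt_clamp; [exact Hx'|].
    exact (cont_deriv _ _ _ _ (Hf x Hx')).
  - rewrite Rmin_left, Rmax_right in Hc by lra.
    rewrite (clamp_id T s), (clamp_id T t) in Heq
      by (unfold time_interval; lra).
    assert (0 <= f' c) by (apply Hpos; unfold time_interval; lra).
    nra.
Qed.

Lemma D_in_of_is_derive f f' D t : is_derive f t (f' t) -> D_in f f' D t.
Proof.
  intros Hf. apply is_derive_Reals in Hf. intros eps Heps.
  destruct (Hf eps Heps) as [d Hd].
  exists d; split; [apply cond_pos|].
  intros x [[_ Hne] Hx]. simpl in *. unfold Rdist in *.
  specialize (Hd (x - t)). replace (t + (x - t)) with x in Hd by ring.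
  apply Hd; [lra|exact Hx].
Qed.

Lemma continue_in_of_derivable f D t : ex_derive f t -> continue_in f D t.
Proof.
  intros [l Hl]. apply cont_deriv with (d := fun _ => l).
  apply D_in_of_is_derive. exact Hl.
Qed.

(** * The solutions of the differential equations, indexed by [z(T) = w] *)

Definition z_sol (T w t : R) : R := 2 * w / (2 + Rabs w * (T - t)).

(** This is [z(0) / z(t)] when [w <> 0]. *)
Definition decay (T w t : R) : R := (2 + Rabs w * (T - t)) / (2 + Rabs w * T).

(** For [w > 0], invariance of [(1 - m) z^2] reads
    [1 - m = decay^2 (1 - m0)], and symmetrically [1 + m = decay^2 (1 + m0)]
    for [w < 0].  Hence [m = decay^2 m0 + sgn(w) (1 - decay^2)], and
    [1 - decay = |w| t / (2 + |w| T)] absorbs the sign, which leaves a formula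
    that also covers [w = 0]. *)
Definition m_sol (T m0 w t : R) : R :=
  decay T w t ^ 2 * m0 + w / (2 + Rabs w * T) * t * (1 + decay T w t).

Lemma denominator_pos w r : 0 <= r -> 0 < 2 + Rabs w * r.
Proof. intros Hr. pose proof (Rabs_pos w). nra. Qed.

Lemma Rabs_z_sol T w t :
  time_interval T t -> Rabs (z_sol T w t) = 2 * Rabs w / (2 + Rabs w * (T - t)).
Proof.
  intros Ht. unfold time_interval in Ht. unfold z_sol, Rdiv.
  assert (0 < 2 + Rabs w * (T - t)) by (apply denominator_pos; lra).
  rewrite !Rabs_mult, Rabs_inv, (Rabs_right 2) by lra.
  rewrite (Rabs_right (2 + _)) by lra. reflexivity.
Qed.

Lemma z_sol_derive T w t : time_interval T t ->
  is_derive (z_sol T w) t (2 * w * Rabs w / (2 + Rabs w * (T - t)) ^ 2).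
Proof.
  intros Ht. unfold time_interval in Ht. unfold z_sol.
  assert (0 < 2 + Rabs w * (T - t)) by (apply denominator_pos; lra).
  auto_derive; [lra|]. field. lra.
Qed.

Lemma m_sol_derive T m0 w t : time_interval T t ->
  is_derive (m_sol T m0 w) t
    (2 * decay T w t * (w - Rabs w * m0) / (2 + Rabs w * T)).
Proof.
  intros Ht. unfold time_interval in Ht. unfold m_sol, decay.
  assert (0 < 2 + Rabs w * T) by (apply denominator_pos; lra).
  auto_derive; [lra|]. field. lra.
Qed.

Lemma z_sol_ode T w t : time_interval T t ->
  D_in (z_sol T w) (fun r => z_sol T w r * Rabs (z_sol T w r) / 2)
    (time_interval T) t.
Proof.
  intros Ht. apply D_in_of_is_derive.
  rewrite Rabs_z_sol by exact Ht.
  assert (0 < 2 + Rabs w * (T - t))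
    by (apply denominator_pos; unfold time_interval in Ht; lra).
  replace (z_sol T w t * (2 * Rabs w / (2 + Rabs w * (T - t))) / 2)
    with (2 * w * Rabs w / (2 + Rabs w * (T - t)) ^ 2)
    by (unfold z_sol; field; lra).
  apply z_sol_derive; exact Ht.
Qed.

Lemma m_sol_ode T m0 w t : time_interval T t ->
  D_in (m_sol T m0 w)
    (fun r => - m_sol T m0 w r * Rabs (z_sol T w r) + z_sol T w r)
    (time_interval T) t.
Proof.
  intros Ht. apply D_in_of_is_derive.
  rewrite Rabs_z_sol by exact Ht.
  unfold time_interval in Ht.
  assert (0 < 2 + Rabs w * (T - t)) by (apply denominator_pos; lra).
  assert (0 < 2 + Rabs w * T) by (apply denominator_pos; lra).
  replace (_ + z_sol T w t)
    with (2 * decay T w t * (w - Rabs w * m0) / (2 + Rabs w * T))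
    by (unfold m_sol, decay, z_sol; field; lra).
  apply m_sol_derive; exact Ht.
Qed.

Lemma z_sol_C1 T w : C1_on T (z_sol T w).
Proof.
  exists (fun t => 2 * w * Rabs w / (2 + Rabs w * (T - t)) ^ 2).
  intros t Ht. split.
  - apply D_in_of_is_derive, z_sol_derive, Ht.
  - apply continue_in_of_derivable. unfold time_interval in Ht.
    assert (0 < 2 + Rabs w * (T - t)) by (apply denominator_pos; lra).
    auto_derive. nra.
Qed.

Lemma m_sol_C1 T m0 w : C1_on T (m_sol T m0 w).
Proof.
  exists (fun t => 2 * decay T w t * (w - Rabs w * m0) / (2 + Rabs w * T)).
  intros t Ht. split.
  - apply D_in_of_is_derive, m_sol_derive, Ht.
  - apply continue_in_of_derivable. unfold time_interval in Ht.
    assert (0 < 2 + Rabs w * T) by (apply denominator_pos; lra).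
    unfold decay. auto_derive. lra.
Qed.

Lemma z_sol_terminal T w : z_sol T w T = w.
Proof. unfold z_sol. rewrite Rminus_diag. field. Qed.

Lemma m_sol_initial T m0 w : 0 < T -> m_sol T m0 w 0 = m0.
Proof.
  intros HT. assert (0 < 2 + Rabs w * T) by (apply denominator_pos; lra).
  unfold m_sol, decay. field. lra.
Qed.

(** * Uniqueness for given [z(T)] and [m(0)] *)

(** The right-hand side [z |z| / 2] is nondecreasing in [z], so the square of
    the distance to [z_sol] is nondecreasing in time; it vanishes at [T]. *)
Lemma z_unique T z :
  (forall t, time_interval T t ->
     D_in z (fun r => z r * Rabs (z r) / 2) (time_interval T) t) ->
  forall t, time_interval T t -> z t = z_sol T (z T) t.
Proof.
  intros Hz t Ht. unfold time_interval in Ht.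
  set (y := z_sol T (z T)).
  assert (Hmono : (z t - y t) * (z t - y t) <= (z T - y T) * (z T - y T)).
  { apply (D_in_nondecreasing T (fun r => (z r - y r) * (z r - y r))
      (fun r =>
        (z r * Rabs (z r) / 2 - y r * Rabs (y r) / 2) * (z r - y r) +
        (z r - y r) * (z r * Rabs (z r) / 2 - y r * Rabs (y r) / 2)));
      try lra.
    - intros r Hr.
      pose proof (Dminus _ _ _ _ _ r (Hz r Hr) (z_sol_ode T (z T) r Hr)) as Hd.
      exact (Dmult _ _ _ _ _ r Hd Hd).
    - intros r _.
      generalize (z r) (y r); intros a b.
      (* Monotonicity of [x |x|], as an explicit nonnegative expression. *)
      replace (_ + _) with
        ((Rabs a + Rabs b) * ((a - b) ^ 2 + (Rabs a - Rabs b) ^ 2) / 2)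
        by (unfold Rabs; repeat destruct (Rcase_abs _); field).
      pose proof (Rabs_pos a). pose proof (Rabs_pos b).
      pose proof (pow2_ge_0 (a - b)). pose proof (pow2_ge_0 (Rabs a - Rabs b)).
      nra. }
  assert (Hend : y T = z T) by apply z_sol_terminal.
  rewrite Hend, Rminus_diag in Hmono. nra.
Qed.

(** The difference [e] of two solutions satisfies [e' = - |z| e], so [e^2] is
    nonincreasing; it vanishes at 0. *)
Lemma m_unique T z m mu :
  (forall t, time_interval T t ->
     D_in m (fun r => - m r * Rabs (z r) + z r) (time_interval T) t) ->
  (forall t, time_interval T t ->
     D_in mu (fun r => - mu r * Rabs (z r) + z r) (time_interval T) t) ->
  m 0 = mu 0 ->
  forall t, time_interval T t -> m t = mu t.
Proof.
  intros Hm Hmu H0 t Ht. unfold time_interval in Ht.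
  set (dm := fun r => - m r * Rabs (z r) + z r) in *.
  set (dmu := fun r => - mu r * Rabs (z r) + z r) in *.
  assert (Hmono : - ((m 0 - mu 0) * (m 0 - mu 0)) <=
                  - ((m t - mu t) * (m t - mu t))).
  { apply (D_in_nondecreasing T (fun r => - ((m r - mu r) * (m r - mu r)))
      (fun r => - ((dm r - dmu r) * (m r - mu r) +
                   (m r - mu r) * (dm r - dmu r)))); try lra.
    - intros r Hr.
      pose proof (Dminus _ _ _ _ _ r (Hm r Hr) (Hmu r Hr)) as Hd.
      exact (Dopp _ _ _ r (Dmult _ _ _ _ _ r Hd Hd)).
    - intros r _. unfold dm, dmu.
      pose proof (Rabs_pos (z r)). pose proof (Rle_0_sqr (m r - mu r)) as Hs.
      unfold Rsqr in Hs. nra. }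
  rewrite H0, Rminus_diag in Hmono. nra.
Qed.

(** * Reduction to a root count *)

(** Up to the factor [(2 + |w| T)^2] and the constant [8 m0], this is the
    defect [w - 2 m(T)] in the terminal condition. *)
Definition shooting (T w : R) : R :=
  w * (4 - 8 * T + (4 * T - 2 * T ^ 2) * Rabs w + T ^ 2 * Rabs w ^ 2).

Lemma terminal_iff_shooting T m0 w : 0 < T ->
  (w = 2 * m_sol T m0 w T <-> shooting T w = 8 * m0).
Proof.
  intros HT. assert (HD : 0 < 2 + Rabs w * T) by (apply denominator_pos; lra).
  assert (E : shooting T w - 8 * m0 =
              (w - 2 * m_sol T m0 w T) * (2 + Rabs w * T) ^ 2)
    by (unfold shooting, m_sol, decay; field; lra).
  assert (0 < (2 + Rabs w * T) ^ 2) by nra.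
  split; intros Hw; nra.
Qed.

Definition sol (T m0 w : R) : (R -> R) * (R -> R) :=
  (z_sol T w, m_sol T m0 w).

Lemma sol_solves T m0 w :
  0 < T -> shooting T w = 8 * m0 -> mfg_solution T m0 (sol T m0 w).
Proof.
  intros HT Hw. constructor; simpl.
  - apply z_sol_C1.
  - apply m_sol_C1.
  - apply z_sol_ode.
  - apply m_sol_ode.
  - rewrite z_sol_terminal. apply terminal_iff_shooting; assumption.
  - apply m_sol_initial, HT.
Qed.

Lemma solution_is_sol T m0 s : 0 < T -> mfg_solution T m0 s ->
  exists w, shooting T w = 8 * m0 /\ agree_on T s (sol T m0 w).
Proof.
  intros HT [_ _ Hz Hm Hend Hini]. destruct s as [z m]; simpl in *.
  pose proof (z_unique T z Hz) as Ez.
  assert (Em : forall t, time_interval T t -> m t = m_sol T m0 (z T) t).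
  { apply (m_unique T z); [exact Hm| |].
    - intros t Ht.
      pose proof (m_sol_ode T m0 (z T) t Ht) as Ho.
      unfold D_in in *. rewrite <- (Ez t Ht) in Ho. exact Ho.
    - rewrite m_sol_initial; assumption. }
  exists (z T). split.
  - apply terminal_iff_shooting; [exact HT|].
    rewrite <- Em by (unfold time_interval; lra). exact Hend.
  - intros t Ht. split; simpl; auto.
Qed.

Lemma NoDup_map_Ropp ws : NoDup ws -> NoDup (map Ropp ws).
Proof.
  intros Hnd. apply NoDup_map_inv with (f := Ropp).
  rewrite map_map, (map_ext _ (fun x => x)), map_id by (intros; ring).
  exact Hnd.
Qed.

Definition shooting_roots (T m0 : R) (ws : list R) : Prop :=
  NoDup ws /\ forall w, In w ws <-> shooting T w = 8 * m0.

Lemma solution_list_of_roots T m0 ws : 0 < T ->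
  shooting_roots T m0 ws -> solution_list T m0 (map (sol T m0) ws).
Proof.
  intros HT [Hnd Hws]. split; [|split].
  - apply Forall_forall. intros s Hs. apply in_map_iff in Hs.
    destruct Hs as [w [<- Hw]]. apply sol_solves, Hws; assumption.
  - clear Hws. induction Hnd as [|w ws Hw Hnd IH]; simpl; constructor; [|exact IH].
    apply Forall_forall. intros s Hs. apply in_map_iff in Hs.
    destruct Hs as [w' [<- Hw']]. intros Ha.
    destruct (Ha T) as [Ez _]; [unfold time_interval; lra|].
    simpl in Ez. rewrite !z_sol_terminal in Ez. congruence.
  - intros s Hs. destruct (solution_is_sol T m0 s HT Hs) as [w [Hw Ha]].
    apply Exists_exists. exists (sol T m0 w). split; [|exact Ha].
    apply in_map, Hws, Hw.
Qed.

Lemma exactly_n_of_roots T m0 ws : 0 < T ->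
  shooting_roots T m0 ws -> exactly_n_solutions (length ws) T m0.
Proof.
  intros HT Hws. exists (map (sol T m0) ws). split.
  - apply length_map.
  - apply solution_list_of_roots; assumption.
Qed.

(** The reflection [(z, m) -> (- z, - m)] maps the system for [m0] to the
    system for [- m0]; on terminal values it is oddness of [shooting]. *)
Lemma shooting_opp T w : shooting T (- w) = - shooting T w.
Proof. unfold shooting. rewrite Rabs_Ropp. ring. Qed.

Lemma shooting_roots_opp T m0 ws :
  shooting_roots T (- m0) ws -> shooting_roots T m0 (map Ropp ws).
Proof.
  intros [Hnd Hws]. split.
  - apply NoDup_map_Ropp, Hnd.
  - intros w. rewrite in_map_iff. split.
    + intros [x [<- Hx]]. apply Hws in Hx. rewrite shooting_opp. lra.
    + intros Hw. exists (- w). split; [ring|].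
      apply Hws. rewrite shooting_opp. lra.
Qed.

(** * Roots of the cubic on the positive axis *)

(** Equal to [8 - (2 - v) (2 + v T)^2]. *)
Definition cubic (T v : R) : R :=
  v * (4 - 8 * T + (4 * T - 2 * T ^ 2) * v + T ^ 2 * v ^ 2).

Lemma shooting_pos T v : 0 <= v -> shooting T v = cubic T v.
Proof. intros Hv. unfold shooting. rewrite Rabs_right by lra. reflexivity. Qed.

Lemma shooting_neg T v : 0 <= v -> shooting T (- v) = - cubic T v.
Proof. intros Hv. rewrite shooting_opp, shooting_pos by exact Hv. reflexivity. Qed.

Lemma continuity_cubic T c : continuity (fun v => cubic T v - c).
Proof. unfold cubic. intros v. apply derivable_continuous_pt. reg. Qed.

Lemma cubic_root_between T c a b : a <= b ->
  (cubic T a - c) * (cubic T b - c) <= 0 ->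
  exists v, a <= v <= b /\ cubic T v = c.
Proof.
  intros Hab Hs.
  destruct (IVT_cor _ a b (continuity_cubic T c) Hab Hs) as [v [Hv E]].
  exists v. split; [exact Hv|lra].
Qed.

(** Division of [cubic - c] by [(x - a) (x - b)] leaves no remainder: these are
    the coefficient of [x] and the constant term of that remainder.  The third
    root [x] satisfies [T^2 x = - (T^2 (a + b) + (4 T - 2 T^2))]. *)
Lemma cubic_two_roots T c a b : a <> b -> cubic T a = c -> cubic T b = c ->
  T ^ 2 * (a ^ 2 + a * b + b ^ 2) + (4 * T - 2 * T ^ 2) * (a + b)
    + (4 - 8 * T) = 0 /\
  a * b * (T ^ 2 * (a + b) + (4 * T - 2 * T ^ 2)) = - c.
Proof.
  unfold cubic. intros Hne Ha Hb. split.
  - apply Rmult_eq_reg_l with (a - b); [|lra]. nra.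
  - apply Rmult_eq_reg_l with (a - b); [|lra].
    transitivity (b * cubic T a - a * cubic T b); unfold cubic; [ring|].
    rewrite Ha, Hb. ring.
Qed.

Definition threshold (T : R) : R := (2 * T - 1) ^ 2 * (T + 4) / (27 * T).

(** The positive critical point of the cubic for [T > 1/2]; the derivative is
    [(2 + v T) (3 v T - (4 T - 2))]. *)
Definition crit (T : R) : R := (4 * T - 2) / (3 * T).

(** The level of the local minimum is [- 8 threshold T]: there the critical
    point is a double root, which leaves a linear factor whose root is
    negative. *)
Lemma cubic_at_crit T v : 0 < T ->
  cubic T v + 8 * threshold T =
  (v - crit T) ^ 2 * (T ^ 2 * v + T * (8 + 2 * T) / 3).
Proof. intros HT. unfold cubic, threshold, crit. field. lra. Qed.

Lemma crit_bounds T : 1 / 2 < T -> 0 < crit T < 2.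
Proof.
  intros HT. unfold crit. split.
  - apply Rdiv_lt_0_compat; lra.
  - apply Rmult_lt_reg_r with (3 * T); [lra|].
    replace ((4 * T - 2) / (3 * T) * (3 * T)) with (4 * T - 2) by (field; lra).
    lra.
Qed.

Lemma cubic_crit T : 0 < T -> cubic T (crit T) = - (8 * threshold T).
Proof. intros HT. pose proof (cubic_at_crit T (crit T) HT). nra. Qed.

Lemma cubic_0 T : cubic T 0 = 0.
Proof. unfold cubic. ring. Qed.

Lemma cubic_2 T : cubic T 2 = 8.
Proof. unfold cubic. ring. Qed.

(** The cubic is below [c] at some point of [[0, 2)], namely 0 or the minimum,
    and equals 8 at 2, which gives a root.  With two positive roots, the third
    is nonnegative because the product of the roots is [c / T^2]; then
    positivity of the sum [2 - 4 / T] of the roots gives [T > 2], while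
    positivity of the sum [(4 - 8 T) / T^2] of their pairwise products gives
    [T < 1/2]. *)
Lemma cubic_increasing_branch T c : 0 < T -> 0 <= c <= 8 -> (c = 0 -> 1 / 2 < T) ->
  exists p, 0 < p /\ forall v, 0 < v -> (cubic T v = c <-> v = p).
Proof.
  intros HT Hc Hc0.
  assert (Hlow : exists a, 0 <= a < 2 /\ cubic T a < c).
  { destruct (Req_dec c 0) as [E|E].
    - exists (crit T). specialize (Hc0 E). pose proof (crit_bounds T Hc0).
      split; [lra|]. rewrite cubic_crit, E by lra.
      assert (0 < threshold T); [|lra].
      unfold threshold. apply Rdiv_lt_0_compat; [|lra].
      apply Rmult_lt_0_compat; [|lra]. apply pow_lt. lra.
    - exists 0. rewrite cubic_0. lra. }
  destruct Hlow as [a [Ha Hac]].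
  destruct (cubic_root_between T c a 2) as [p [Hp Ep]]; [lra| |].
  { rewrite cubic_2. nra. }
  assert (p <> a) by (intros ->; lra).
  exists p. split; [lra|]. intros v Hv. split; [|intros ->; exact Ep].
  intros Ev. destruct (Req_dec v p) as [E|Hne]; [exact E|exfalso].
  destruct (cubic_two_roots T c v p Hne Ev Ep) as [E1 E2].
  set (k := T ^ 2 * (v + p) + (4 * T - 2 * T ^ 2)) in *.
  assert (Hvp : 0 < v * p) by (apply Rmult_lt_0_compat; lra).
  assert (HT2 : 0 < T ^ 2) by (apply pow_lt; lra).
  assert (E1' : (v + p) * k - T ^ 2 * (v * p) + (4 - 8 * T) = 0)
    by (rewrite <- E1; unfold k; ring).
  assert (Hk : k <= 0) by nra.
  assert (HT12 : 1 / 2 < T).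
  { assert (0 < T ^ 2 * (v + p)) by (apply Rmult_lt_0_compat; lra).
    assert (4 * T - 2 * T ^ 2 < 0) by (unfold k in Hk; lra).
    nra. }
  assert (0 < T ^ 2 * (v * p)) by (apply Rmult_lt_0_compat; lra).
  nra.
Qed.

Lemma cubic_pos_short T v : 0 < T <= 1 / 2 -> 0 < v -> 0 < cubic T v.
Proof.
  intros HT Hv. unfold cubic. apply Rmult_lt_0_compat; [exact Hv|].
  assert (0 < T ^ 2 * v ^ 2)
    by (apply Rmult_lt_0_compat; apply pow_lt; lra).
  assert (0 <= (4 * T - 2 * T ^ 2) * v) by (apply Rmult_le_pos; nra).
  lra.
Qed.

Lemma cofactor_pos T v : 0 < T -> 0 < v -> 0 < T ^ 2 * v + T * (8 + 2 * T) / 3.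
Proof.
  intros HT Hv. assert (0 < T ^ 2 * v) by (apply Rmult_lt_0_compat; [apply pow_lt|]; lra).
  nra.
Qed.

Lemma cubic_above_threshold T v : 0 < T -> 0 < v -> - (8 * threshold T) <= cubic T v.
Proof.
  intros HT Hv. pose proof (cubic_at_crit T v HT). pose proof (cofactor_pos T v HT Hv).
  pose proof (pow2_ge_0 (v - crit T)). nra.
Qed.

Lemma cubic_at_threshold T v : 1 / 2 < T -> 0 < v ->
  (cubic T v = - (8 * threshold T) <-> v = crit T).
Proof.
  intros HT Hv. split; [|intros ->; apply cubic_crit; lra].
  intros E. assert (HT0 : 0 < T) by lra.
  pose proof (cubic_at_crit T v HT0) as F. pose proof (cofactor_pos T v HT0 Hv) as G.
  rewrite E in F. replace (- (8 * threshold T) + 8 * threshold T) with 0 in F by ring.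
  symmetry in F. apply Rmult_integral in F. destruct F as [F|F]; [|lra].
  nra.
Qed.

(** The level [- 8 m] lies strictly between the minimum of the cubic and its
    value at 0, so it is attained on both sides of [crit T].  The product of
    the roots is negative, so at most two of them are positive. *)
Lemma cubic_below_threshold T m : 1 / 2 < T -> 0 < m < threshold T ->
  exists a b, 0 < a < b /\
    forall v, 0 < v -> (cubic T v = - (8 * m) <-> v = a \/ v = b).
Proof.
  intros HT Hm. pose proof (crit_bounds T HT) as Hc.
  pose proof (cubic_crit T ltac:(lra)) as Ec.
  destruct (cubic_root_between T (- (8 * m)) 0 (crit T)) as [a [Ha Ea]];
    [lra|rewrite cubic_0; nra|].
  destruct (cubic_root_between T (- (8 * m)) (crit T) 2) as [b [Hb Eb]];
    [lra|rewrite cubic_2; nra|].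
  assert (a <> 0) by (intros ->; rewrite cubic_0 in Ea; lra).
  assert (a <> crit T) by (intros ->; lra).
  exists a, b. split; [lra|].
  intros v Hv. split; [|intros [-> | ->]; assumption].
  intros Ev. destruct (Req_dec v a) as [|Na]; [auto|].
  destruct (Req_dec v b) as [|Nb]; [auto|exfalso].
  destruct (cubic_two_roots T (- (8 * m)) a b) as [E1 F1]; [lra|assumption..|].
  destruct (cubic_two_roots T (- (8 * m)) a v) as [E2 _]; [lra|assumption..|].
  assert (E3 : T ^ 2 * (a + b + v) + (4 * T - 2 * T ^ 2) = 0).
  { apply Rmult_eq_reg_l with (b - v); [|lra].
    rewrite Rmult_0_r, <- (Rminus_diag 0). rewrite <- E1 at 1. rewrite <- E2. ring. }
  assert (0 < a * b) by (apply Rmult_lt_0_compat; lra).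
  assert (0 < T ^ 2 * v) by (apply Rmult_lt_0_compat; [apply pow_lt|]; lra).
  assert (T ^ 2 * (a + b) + (4 * T - 2 * T ^ 2) < 0) by lra.
  nra.
Qed.

(** * The transition time *)

(** Up to a constant and a factor 27, [threshold T] is
    [4 T^2 + 12 T + 4 / T]; the bound [a b > 1/4] makes the increase of the
    first two terms exceed the decrease of the last. *)
Lemma threshold_increasing a b : 1 / 2 <= a < b -> threshold a < threshold b.
Proof.
  intros Hab.
  assert (Hpos : 0 < a * b) by nra.
  assert (E : threshold b - threshold a =
    (b - a) * ((4 * (a + b) + 12) * (a * b) - 4) / (27 * (a * b)))
    by (unfold threshold; field; lra).
  enough (0 < threshold b - threshold a) by lra.
  rewrite E. apply Rdiv_lt_0_compat; [|lra].
  apply Rmult_lt_0_compat; [lra|]. nra.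
Qed.

Lemma transition_time_exists m0 : -1 <= m0 <= 1 ->
  exists Tm, transition_time m0 Tm.
Proof.
  intros Hm.
  assert (Habs : 0 <= Rabs m0 <= 1) by (split; [apply Rabs_pos|apply Rabs_le; lra]).
  set (g := fun T => (2 * T - 1) ^ 2 * (T + 4) - 27 * T * Rabs m0).
  assert (Hg : continuity g)
    by (unfold g; intros x; apply derivable_continuous_pt; reg).
  destruct (IVT_cor g (1 / 2) 2 Hg) as [x [Hx E]]; [lra|unfold g; nra|].
  exists x. split; [exact Hx|]. unfold g in E.
  apply Rmult_eq_reg_r with (27 * x); [|lra].
  transitivity ((2 * x - 1) ^ 2 * (x + 4)); [lra|field; lra].
Qed.

Lemma transition_time_unique m0 T T' :
  transition_time m0 T -> transition_time m0 T' -> T = T'.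
Proof.
  intros [H1 E1] [H2 E2]. fold (threshold T) in E1. fold (threshold T') in E2.
  destruct (Rtotal_order T T') as [H|[H|H]]; [exfalso|exact H|exfalso].
  - pose proof (threshold_increasing T T'). lra.
  - pose proof (threshold_increasing T' T). lra.
Qed.

(** * Counting the roots of the shooting equation *)

Lemma shooting_roots_intro T m0 p ns :
  0 < m0 -> 0 < p ->
  (forall v, 0 < v -> (cubic T v = 8 * m0 <-> v = p)) ->
  NoDup ns -> (forall v, In v ns -> 0 < v) ->
  (forall v, 0 < v -> (cubic T v = - (8 * m0) <-> In v ns)) ->
  shooting_roots T m0 (p :: map Ropp ns).
Proof.
  intros Hm Hp Hpos Hnd Hns Hneg. split.
  - constructor.
    + intros Hin. apply in_map_iff in Hin. destruct Hin as [x [E Hx]].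
      apply Hns in Hx. lra.
    + apply NoDup_map_Ropp, Hnd.
  - intros w. simpl. rewrite in_map_iff.
    destruct (Rtotal_order w 0) as [Hw|[->|Hw]].
    + rewrite <- (Ropp_involutive w), shooting_neg by lra. split.
      * intros [E|[x [E Hx]]]; [lra|].
        replace (- w) with x by lra. apply Hneg in Hx; [lra|auto].
      * intros E. right. exists (- w). split; [reflexivity|].
        apply Hneg; lra.
    + rewrite shooting_pos, cubic_0 by lra. split; [|lra].
      intros [E|[x [E Hx]]]; [lra|]. apply Hns in Hx. lra.
    + rewrite shooting_pos by lra. rewrite Hpos by exact Hw. split.
      * intros [E|[x [E Hx]]]; [auto|]. apply Hns in Hx. lra.
      * auto.
Qed.

Lemma shooting_roots_count_pos m0 Tm T : 0 < m0 <= 1 ->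
  transition_time m0 Tm -> 0 < T ->
  (T < Tm -> exists ws, length ws = 1%nat /\ shooting_roots T m0 ws) /\
  (T = Tm -> exists ws, length ws = 2%nat /\ shooting_roots T m0 ws) /\
  (Tm < T -> exists ws, length ws = 3%nat /\ shooting_roots T m0 ws).
Proof.
  intros Hm [HTm E] HT. rewrite Rabs_right in E by lra. fold (threshold Tm) in E.
  assert (HTm' : 1 / 2 < Tm).
  { destruct (Req_dec Tm (1 / 2)) as [E'|]; [|lra].
    rewrite E' in E. unfold threshold in E. lra. }
  destruct (cubic_increasing_branch T (8 * m0)) as [p [Hp Hpr]]; [lra..|].
  split; [|split]; intros HTT.
  - exists (p :: map Ropp []). split; [reflexivity|].
    apply shooting_roots_intro; auto; [lra|constructor|intros v []|].
    intros v Hv. split; [|intros []]. intros Ev.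
    destruct (Rle_dec T (1 / 2)).
    + pose proof (cubic_pos_short T v). lra.
    + pose proof (threshold_increasing T Tm).
      pose proof (cubic_above_threshold T v). lra.
  - exists (p :: map Ropp [crit T]). split; [reflexivity|].
    subst Tm. pose proof (crit_bounds T HTm').
    apply shooting_roots_intro; auto; [lra|repeat constructor; simpl; tauto| |].
    + intros v [<-|[]]. lra.
    + intros v Hv. rewrite E, cubic_at_threshold by lra. simpl. intuition.
  - pose proof (threshold_increasing Tm T).
    destruct (cubic_below_threshold T m0) as [a [b [Hab Hr]]]; [lra..|].
    exists (p :: map Ropp [a; b]). split; [reflexivity|].
    apply shooting_roots_intro; auto; [lra| | |].
    + repeat constructor; simpl; intuition lra.
    + intros v [<-|[<-|[]]]; lra.
    + intros v Hv. rewrite Hr by lra. simpl. intuition.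
Qed.

Lemma shooting_roots_count m0 Tm T : -1 <= m0 <= 1 -> m0 <> 0 ->
  transition_time m0 Tm -> 0 < T ->
  (T < Tm -> exists ws, length ws = 1%nat /\ shooting_roots T m0 ws) /\
  (T = Tm -> exists ws, length ws = 2%nat /\ shooting_roots T m0 ws) /\
  (Tm < T -> exists ws, length ws = 3%nat /\ shooting_roots T m0 ws).
Proof.
  intros Hm Hne HTm HT. destruct (Rtotal_order m0 0) as [Hs|[Hs|Hs]]; [|lra|].
  - assert (HTm' : transition_time (- m0) Tm)
      by (unfold transition_time; rewrite Rabs_Ropp; exact HTm).
    destruct (shooting_roots_count_pos (- m0) Tm T ltac:(lra) HTm' HT)
      as [H1 [H2 H3]].
    split; [|split]; intros H;
      [destruct (H1 H) as [ws [L Hws]]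
      |destruct (H2 H) as [ws [L Hws]]
      |destruct (H3 H) as [ws [L Hws]]];
      exists (map Ropp ws); rewrite length_map; split;
      auto using shooting_roots_opp.
  - apply shooting_roots_count_pos; auto; lra.
Qed.

(** * The symmetric case [m0 = 0] *)

Lemma shooting_0 T : shooting T 0 = 0.
Proof. unfold shooting. ring. Qed.

Lemma shooting_roots_zero_short T : 0 < T <= 1 / 2 -> shooting_roots T 0 [0].
Proof.
  intros HT. split; [repeat constructor; simpl; tauto|].
  intros w. simpl. rewrite Rmult_0_r. split.
  - intros [<-|[]]. apply shooting_0.
  - intros Hw. left. destruct (Rtotal_order w 0) as [H|[H|H]]; [exfalso|auto|exfalso].
    + rewrite <- (Ropp_involutive w), shooting_neg in Hw by lra.
      pose proof (cubic_pos_short T (- w)). lra.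
    + rewrite shooting_pos in Hw by lra. pose proof (cubic_pos_short T w). lra.
Qed.

Lemma shooting_roots_zero_long T : 1 / 2 < T ->
  exists p, 0 < p /\ shooting_roots T 0 [0; p; - p].
Proof.
  intros HT. destruct (cubic_increasing_branch T 0) as [p [Hp Hr]]; [lra..|].
  exists p. split; [exact Hp|]. split.
  - repeat constructor; simpl; intuition lra.
  - intros w. simpl. rewrite Rmult_0_r. split.
    + intros [<-|[<-|[<-|[]]]]; [apply shooting_0| |].
      * rewrite shooting_pos by lra. apply Hr; lra.
      * rewrite shooting_neg by lra. rewrite (proj2 (Hr p Hp)) by reflexivity. ring.
    + intros Hw. destruct (Rtotal_order w 0) as [H|[H|H]]; [|auto|].
      * rewrite <- (Ropp_involutive w), shooting_neg in Hw by lra.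
        assert (- w = p) by (apply Hr; lra). right; right; left. lra.
      * rewrite shooting_pos in Hw by lra. right; left. symmetry. apply Hr; lra.
Qed.

Lemma sol_zero T : sol T 0 0 = ((fun _ => 0), (fun _ => 0)).
Proof.
  unfold sol. f_equal; apply functional_extensionality; intros t;
    unfold z_sol, m_sol, Rdiv; ring.
Qed.

Lemma m_sol_opp T w t : m_sol T 0 (- w) t = - m_sol T 0 w t.
Proof. unfold m_sol, decay, Rdiv. rewrite Rabs_Ropp. ring. Qed.

Lemma m_sol_pos T w t : 0 < w -> 0 < t <= T -> 0 < m_sol T 0 w t.
Proof.
  intros Hw Ht. unfold m_sol.
  assert (HD : 0 < 2 + Rabs w * T) by (apply denominator_pos; lra).
  assert (0 < decay T w t)
    by (apply Rdiv_lt_0_compat; [apply denominator_pos|]; lra).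
  rewrite Rmult_0_r, Rplus_0_l.
  repeat apply Rmult_lt_0_compat; try lra. apply Rinv_0_lt_compat, HD.
Qed.

Theorem proposition2 :
  forall m0 : R, -1 <= m0 <= 1 ->
  exists Tm : R,
    unique (transition_time m0) Tm /\
    (m0 <> 0 -> forall T : R, 0 < T ->
       (T < Tm -> exactly_n_solutions 1 T m0) /\
       (T = Tm -> exactly_n_solutions 2 T m0) /\
       (Tm < T -> exactly_n_solutions 3 T m0)) /\
    (m0 = 0 ->
       Tm = 1 / 2 /\
       forall T : R, 0 < T ->
         (T <= 1 / 2 -> exactly_n_solutions 1 T m0) /\
         (1 / 2 < T ->
            exists zp mp zm mm : R -> R,
              solution_list T m0
                [((fun _ => 0), (fun _ => 0)); (zp, mp); (zm, mm)] /\
              (forall t : R, 0 < t <= T -> mp t = - mm t /\ mp t > 0))).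
Proof.
  intros m0 Hm. destruct (transition_time_exists m0 Hm) as [Tm HTm].
  exists Tm. split; [|split].
  - split; [exact HTm|]. intros T'. apply transition_time_unique, HTm.
  - intros Hne T HT.
    destruct (shooting_roots_count m0 Tm T Hm Hne HTm HT) as [H1 [H2 H3]].
    split; [|split]; intros H;
      [destruct (H1 H) as [ws [<- Hws]]
      |destruct (H2 H) as [ws [<- Hws]]
      |destruct (H3 H) as [ws [<- Hws]]];
      apply exactly_n_of_roots; assumption.
  - intros ->. split.
    + apply (transition_time_unique 0); [exact HTm|].
      split; [lra|]. rewrite Rabs_R0. field.
    + intros T HT. split; intros HT'.
      * apply (exactly_n_of_roots T 0 [0] HT), shooting_roots_zero_short. lra.
      * destruct (shooting_roots_zero_long T HT') as [p [Hp Hws]].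
        exists (z_sol T p), (m_sol T 0 p), (z_sol T (- p)), (m_sol T 0 (- p)).
        split.
        -- rewrite <- (sol_zero T).
           exact (solution_list_of_roots T 0 _ HT Hws).
        -- intros t Ht. rewrite m_sol_opp, Ropp_involutive.
           split; [reflexivity|]. apply m_sol_pos; assumption.
Qed.
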